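(* Let $G$ be a second-countable, compact group. Let $\mathcal{D}$ be a separable, unital $C^*$-algebra and $\gamma: G\curvearrowright\mathcal{D}$ an action. Then $\gamma$ is strongly self-absorbing if and only if $\gamma$ is semi-strongly self-absorbing.
   Context: Actions are point-norm continuous homomorphisms $G\to\mathrm{Aut}(\cdot)$; $\otimes$ is the minimal tensor product; $\mathcal{U}(\cdot)$ is the unitary group; $\mathrm{Ad}(u)(x)=uxu^*$. For actions on unital $C^*$-algebras, two unital equivariant $*$-homomorphisms $\varphi_1,\varphi_2: (B,\beta)\to(C,\delta)$ are approximately $G$-unitarily equivalent if there is a sequence $v_n\in\mathcal{U}(C)$ with $\varphi_2(b)=\lim_n v_n\varphi_1(b)v_n^*$ for all $b\in B$ and $\max_{g\in K}\|\delta_g(v_n)-v_n\|\to0$ for every compact $K\subset G$. An action $\gamma: G\curvearrowright\mathcal{D}$ on a separable unital $C^*$-algebra is strongly self-absorbing if the embedding $\mathrm{id}_{\mathcal D}\otimes\mathbf 1_{\mathcal D}: (\mathcal{D},\gamma)\to(\mathcal{D}\otimes\mathcal{D},\gamma\otimes\gamma)$ is approximately $G$-unitarily equivalent to an (equivariant) isomorphism. Two actions $\alpha: G\curvearrowright A$, $\beta: G\curvearrowright B$ on unital $C^*$-algebras are strongly cocycle conjugate if there are an isomorphism $\varphi: A\to B$, a norm-continuous map $v: G\to\mathcal{U}(B)$ and a sequence $x_n\in\mathcal{U}(B)$ such that, with $\alpha'_g=\varphi\circ\alpha_g\circ\varphi^{-1}$, one has $\beta_g=\mathrm{Ad}(v_g)\circ\alpha'_g$,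 $v_{st}=v_s\alpha'_s(v_t)$ for all $g,s,t\in G$, and $x_n\alpha'_g(x_n^* )\to v_g$ in norm, uniformly for $g$ in compact subsets of $G$. An action on a separable unital $C^*$-algebra is semi-strongly self-absorbing if it is strongly cocycle conjugate to a strongly self-absorbing action. *)

(* Defs.v *)
From HB Require Import structures.
From mathcomp Require Import all_boot all_order all_algebra sesquilinear.
From mathcomp Require Import complex.
From mathcomp Require Import all_classical all_reals all_analysis.

Set Implicit Arguments.
Unset Strict Implicit.
Unset Printing Implicit Defensive.
Import Order.TTheory GRing.Theory Num.Theory.
Import numFieldNormedType.Exports.
Local Open Scope classical_set_scope.
Local Open Scope ring_scope.

HB.mixin Record isTopologicalGroup G of Group G & Topological G := {
  mulg_cts : continuous (fun p : G * G => (p.1 * p.2)%g) ;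
  invg_cts : continuous (fun x : G => (x^-1)%g)
}.

#[short(type="topologicalGroupType")]
HB.structure Definition TopologicalGroup :=
  {G of Group G & Topological G & isTopologicalGroup G}.

(* The ring operations are fields of the mixin because the hierarchy has no join
   of rings and normed modules below number domains; the ring structure is
   recovered by the canonical instance declared afterwards.  The zero algebra is
   allowed. *)
HB.mixin Record isCStarAlgebra (R : realType) A
    of CompleteNormedModule R[i] A := {
  cstar_one : A ;
  cstar_mul : A -> A -> A ;
  star : A -> A ;
  cstar_mulA : associative cstar_mul ;
  cstar_mul1r : left_id cstar_one cstar_mul ;
  cstar_mulr1 : right_id cstar_one cstar_mul ;
  cstar_mulDl : left_distributive cstar_mul +%R ;
  cstar_mulDr : right_distributive cstar_mul +%R ;
  cstar_scalerAl : forall (k : R[i]) (x y : A),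
    k *: cstar_mul x y = cstar_mul (k *: x) y ;
  cstar_scalerAr : forall (k : R[i]) (x y : A),
    k *: cstar_mul x y = cstar_mul x (k *: y) ;
  cstar_normM : forall x y : A, `|cstar_mul x y| <= `|x| * `|y| ;
  starK : involutive star ;
  starD : {morph star : x y / x + y} ;
  starZ : forall (k : R[i]) (x : A), star (k *: x) = Num.conj k *: star x ;
  starM : forall x y : A, star (cstar_mul x y) = cstar_mul (star y) (star x) ;
  cstar_norm : forall x : A, `|cstar_mul (star x) x| = `|x| ^+ 2
}.

#[short(type="cstarAlgType")]
HB.structure Definition CStarAlgebra (R : realType) :=
  {A of CompleteNormedModule R[i] A & isCStarAlgebra R A}.

HB.instance Definition _ (R : realType) (A : cstarAlgType R) :=
  GRing.Zmodule_isPzRing.Build (CStarAlgebra.sort A)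
    cstar_mulA cstar_mul1r cstar_mulr1 cstar_mulDl cstar_mulDr.

Definition separable (T : topologicalType) :=
  exists2 S : set T, countable S & dense S.

Definition unitary (R : realType) (A : cstarAlgType R) : set A :=
  [set u | star u * u = 1 /\ u * star u = 1].

Record star_hom (R : realType) (A B : cstarAlgType R) (phi : A -> B) : Prop :=
  StarHom {
    star_hom_linear : linear phi ;
    star_homM : {morph phi : x y / x * y} ;
    star_hom1 : phi 1 = 1 ;
    star_hom_star : {morph phi : x / star x}
  }.

Definition star_iso (R : realType) (A B : cstarAlgType R) (phi : A -> B) :=
  star_hom phi /\ bijective phi.

(* The inner product is linear in its first argument. *)
Record hilbert (R : realType) := Hilbert {
  hilbert_space :> completeNormedModType R[i] ;
  inner : {dot hilbert_space for Num.conj} ;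
  innerE : forall x, inner x x = `|x| ^+ 2
}.
Arguments inner {R} h.
Arguments innerE {R} h x.

Record representation (R : realType) (A : cstarAlgType R) (H : hilbert R)
    (pi : A -> H -> H) : Prop := Representation {
  rep_linear : forall a, linear (pi a) ;
  rep_cts : forall a, continuous (pi a) ;
  repP : forall (k : R[i]) a b h, pi (k *: a + b) h = k *: pi a h + pi b h ;
  repM : forall a b h, pi (a * b) h = pi a (pi b h) ;
  rep1 : forall h, pi 1 h = h ;
  rep_star : forall a h h', inner H (pi a h) h' = inner H h (pi (star a) h')
}.

Definition faithful_representation (R : realType) (A : cstarAlgType R)
    (H : hilbert R) (pi : A -> H -> H) :=
  representation pi /\ forall a, (forall h, pi a h = 0) -> a = 0.

Definition lin_span (K : pzRingType) (V : lmodType K) (S : set V) : set V :=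
  [set x | exists n (c : 'I_n -> K) (s : 'I_n -> V),
     (forall i, S (s i)) /\ x = \sum_i c i *: s i].

Definition elementary (A B T : Type) (tau : A -> B -> T) : set T :=
  [set x | exists a b, x = tau a b].

Definition bilinear_map (K : pzRingType) (U V W : lmodType K)
    (tau : U -> V -> W) :=
  (forall v, linear (tau^~ v)) /\ (forall u, linear (tau u)).

Definition hilbert_tensor (R : realType) (H K L : hilbert R)
    (tau : H -> K -> L) :=
  [/\ bilinear_map tau,
      forall h k h' k',
        inner L (tau h k) (tau h' k') = inner H h h' * inner K k k' &
      dense (lin_span (elementary tau))].

(* [min_tensor iota] : [T], with elementary tensors [iota a b], is the minimal
   (spatial) tensor product of [A] and [B].  For faithful representations [pi]
   and [rho] on [H] and [K], [Pi] identifies [T] (isometrically, being faithful)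
   with the closed span of the operators [pi a (x) rho b] in [B(H (x) K)].  As
   usual, the result does not depend on the choice of [pi] and [rho]; it is
   unique up to a unique isomorphism compatible with elementary tensors. *)
Definition min_tensor (R : realType) (A B T : cstarAlgType R)
    (iota : A -> B -> T) :=
  [/\ bilinear_map iota,
      dense (lin_span (elementary iota)) &
      exists (H K L : hilbert R) (tau : H -> K -> L)
             (pi : A -> H -> H) (rho : B -> K -> K) (Pi : T -> L -> L),
        [/\ hilbert_tensor tau,
            faithful_representation pi,
            faithful_representation rho,
            faithful_representation Pi &
            forall a b h k, Pi (iota a b) (tau h k) = tau (pi a h) (rho b k)]].

Record action (R : realType) (G : topologicalGroupType) (A : cstarAlgType R) :=
  Action {
    act :> G -> A -> A ;
    act_iso : forall g, star_iso (act g) ;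
    actM : forall g h a, act (g * h)%g a = act g (act h a) ;
    act_cts : forall a, continuous (fun g => act g a)
  }.

Definition equivariant (R : realType) (G : topologicalGroupType)
    (A B : cstarAlgType R) (alpha : action G A) (beta : action G B)
    (phi : A -> B) :=
  forall g a, phi (alpha g a) = beta g (phi a).

(* Meant for unital equivariant *-homomorphisms [phi1], [phi2]; the condition
   [max_(g in K) |delta_g v_n - v_n| -> 0] is spelled out with epsilons so as
   to make sense for empty [K] too. *)
Definition approx_unitarily_equivalent (R : realType)
    (G : topologicalGroupType) (B C : cstarAlgType R) (delta : action G C)
    (phi1 phi2 : B -> C) :=
  exists v : nat -> C,
    [/\ forall n, unitary (v n),
        forall b, v n * phi1 b * star (v n) @[n --> \oo] --> phi2 b &
        forall K : set G, compact K -> forall e : R[i], 0 < e ->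
          \forall n \near \oo, forall g, K g -> `|delta g (v n) - v n| < e].

Definition strongly_self_absorbing (R : realType) (G : topologicalGroupType)
    (D : cstarAlgType R) (gamma : action G D) :=
  separable D /\
  exists (T : cstarAlgType R) (iota : D -> D -> T) (gamma2 : action G T)
         (Phi : D -> T),
    [/\ min_tensor iota,
        forall g a b, gamma2 g (iota a b) = iota (gamma g a) (gamma g b),
        star_iso Phi,
        equivariant gamma gamma2 Phi &
        approx_unitarily_equivalent gamma2 (fun a => iota a 1) Phi].

Definition strongly_cocycle_conjugate (R : realType) (G : topologicalGroupType)
    (A B : cstarAlgType R) (alpha : action G A) (beta : action G B) :=
  exists (phi : A -> B) (phi_inv : B -> A) (v : G -> B) (x : nat -> B),
    let alpha' g b := phi (alpha g (phi_inv b)) in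
    [/\ [/\ star_hom phi, cancel phi phi_inv & cancel phi_inv phi],
        continuous v /\ (forall g, unitary (v g)) /\ (forall n, unitary (x n)),
        forall g b, beta g b = v g * alpha' g b * star (v g),
        forall s t, v (s * t)%g = v s * alpha' s (v t) &
        forall K : set G, compact K -> forall e : R[i], 0 < e ->
          \forall n \near \oo, forall g, K g ->
            `|x n * alpha' g (star (x n)) - v g| < e].

Definition semi_strongly_self_absorbing (R : realType)
    (G : topologicalGroupType) (D : cstarAlgType R) (gamma : action G D) :=
  separable D /\
  exists (E : cstarAlgType R) (delta : action G E),
    strongly_self_absorbing delta /\ strongly_cocycle_conjugate gamma delta.

(* Main.v *)
Require Import Defs.
From mathcomp Require Import all_boot all_order all_algebra complex.
From mathcomp Require Import all_classical all_reals all_analysis lra ring.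

(* A strong cocycle conjugacy from [gamma] to [delta] provides a [delta]-twisted cocycle
   [v] that is a uniform limit of coboundaries; when [G] is compact such a cocycle is a
   coboundary.  Indeed [T_g z = delta_g(z) v_g] is a linear isometric action of [G], and a
   unitary [x] whose coboundary is close to [v] is almost fixed by [T].  Averaging the orbit
   of [x] yields an exact fixed point [z] near [x], and the unitary part [y] of the polar
   decomposition of [z] is still fixed by [T].  Composing the given isomorphism with [Ad y]
   then makes it equivariant, and strong self-absorption is invariant under equivariant
   isomorphisms. *)

Set Implicit Arguments.
Unset Strict Implicit.
Unset Printing Implicit Defensive.
Import Order.TTheory GRing.Theory Num.Theory.
Import numFieldNormedType.Exports.
Local Open Scope classical_set_scope.
Local Open Scope ring_scope.
Local Open Scope complex_scope.

(** * Norm estimates in normed spaces over R[i] *)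

Section RealNorm.
Context {R : realType} {V : completeNormedModType R[i]}.
Implicit Types (x y z : V) (r : R).

(* The norm of a normed space over [R[i]] takes its values in [R[i]]; its real part carries
   the same information in a totally ordered field. *)
Definition rnorm x : R := complex.Re `|x|.

Lemma normE x : `|x| = (rnorm x)%:C.
Proof. by rewrite /rnorm RRe_real // normr_real. Qed.

Lemma rnorm_ge0 x : 0 <= rnorm x.
Proof. by rewrite -ler0c -normE. Qed.

Lemma rnorm0 : rnorm 0 = 0.
Proof. by rewrite /rnorm normr0. Qed.

Lemma rnorm_eq0 x : rnorm x <= 0 -> x = 0.
Proof.
move=> x0; apply/eqP; rewrite -normr_eq0 normE; apply/eqP; congr (_%:C).
by apply/eqP; rewrite eq_le x0 rnorm_ge0.
Qed.

Lemma rnormN x : rnorm (- x) = rnorm x.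
Proof. by rewrite /rnorm normrN. Qed.

Lemma rnormB x y : rnorm (x - y) = rnorm (y - x).
Proof. by rewrite -rnormN opprB. Qed.

Lemma rnormD x y : rnorm (x + y) <= rnorm x + rnorm y.
Proof. by rewrite -lecR rmorphD /= -!normE ler_normD. Qed.

Lemma rnorm_triangle z x y : rnorm (x - y) <= rnorm (x - z) + rnorm (z - y).
Proof. by rewrite -{1}(subrK z x) -addrA rnormD. Qed.

Lemma rnorm_sum (I : Type) (s : seq I) (F : I -> V) :
  rnorm (\sum_(i <- s) F i) <= \sum_(i <- s) rnorm (F i).
Proof.
elim/big_rec2: _ => [|i y x _ xy]; first by rewrite rnorm0.
exact: le_trans (rnormD _ _) (lerD (lexx _) xy).
Qed.

Lemma rnormZ r x : 0 <= r -> rnorm (r%:C *: x) = r * rnorm x.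
Proof.
move=> r0; apply: complexI; rewrite rmorphM /= -!normE normrZ.
by rewrite ger0_norm // ler0c.
Qed.

Lemma ltr_normE (e : R[i]) x : 0 < e -> (`|x| < e) = (rnorm x < complex.Re e).
Proof.
by move=> e0; rewrite normE -{1}(RRe_real (gtr0_real e0)) ltcR.
Qed.

Lemma gt0_Re (e : R[i]) : 0 < e -> 0 < complex.Re e.
Proof. by rewrite ltcE => /andP[]. Qed.

Lemma near_rnormP {T : Type} {F : set_system T} {FF : Filter F} (f : T -> V) x :
  f t @[t --> F] --> x <->
  forall e : R, 0 < e -> \forall t \near F, rnorm (x - f t) < e.
Proof.
rewrite cvgrPdist_lt; split=> fx e e0.
- have e0' : 0 < e%:C by rewrite ltcR.
  by apply: filterS (fx _ e0') => t; rewrite ltr_normE.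
- by apply: filterS (fx _ (gt0_Re e0)) => t; rewrite ltr_normE.
Qed.

Lemma geometric_small (q C e : R) : 0 <= q -> q < 1 -> 0 < e ->
  exists n, forall k, (n <= k)%N -> C * q ^+ k < e.
Proof.
move=> q0 q1 e0.
have /(@cvgrPdist_lt _ R^o) : C * q ^+ k @[k --> \oo] --> C * 0.
  by apply: cvgMr; apply: cvg_expr; rewrite ger0_norm.
rewrite mulr0 => /(_ e e0) [n _ nP].
exists n => k nk; have /= := nP k nk.
by rewrite sub0r normrN; apply: le_lt_trans (ler_norm _).
Qed.

(** Limit identities below go through this criterion: both sides are compared with an expression in
    the n-th iterate, with geometrically small error. *)
Lemma geometric_eq0 (q C : R) x : 0 <= q -> q < 1 ->
  (forall n, rnorm x <= C * q ^+ n) -> x = 0.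
Proof.
move=> q0 q1 xC; apply: rnorm_eq0; rewrite leNgt; apply/negP => x0.
have [n /(_ n (leqnn n))] := geometric_small C q0 q1 x0.
by apply/negP; rewrite -leNgt xC.
Qed.

Lemma geometric_cvg (q C : R) (u : nat -> V) : 0 <= q -> q < 1 ->
  (forall n, rnorm (u n.+1 - u n) <= C * q ^+ n) ->
  exists l, forall n, rnorm (l - u n) <= C / (1 - q) * q ^+ n.
Proof.
move=> q0 q1 uC.
have q1' : 0 < 1 - q by rewrite subr_gt0.
have C0 : 0 <= C by have := uC 0; rewrite expr0 mulr1; apply: le_trans (rnorm_ge0 _).
have qn0 n : 0 <= q ^+ n by rewrite exprn_ge0.
(* Keeping the exact partial geometric sum, not just its bound, lets the induction on [k] close. *)
have ctail n k : rnorm (u (n + k)%N - u n) <= C / (1 - q) * (q ^+ n - q ^+ (n + k)).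
  elim: k => [|k IH]; first by rewrite addn0 !subrr rnorm0 mulr0.
  rewrite addnS; apply: le_trans (rnorm_triangle (u (n + k)%N) _ _) _.
  apply: le_trans (lerD (uC _) IH) _.
  rewrite le_eqVlt; apply/orP; left; apply/eqP; rewrite exprS; field.
  by rewrite gt_eqF.
have tail n m : (n <= m)%N -> rnorm (u m - u n) <= C / (1 - q) * q ^+ n.
  move=> nm; rewrite -(subnKC nm); apply: le_trans (ctail _ _) _.
  by rewrite ler_wpM2l ?divr_ge0 ?(ltW q1') // gerBl.
have /cauchy_cvg ul : cauchy (u n @[n --> \oo]).
  apply/(@cauchyP R[i] V) => e e0.
  have [n nP] := geometric_small (C / (1 - q)) q0 q1 (gt0_Re e0).
  exists (u n); exists n => // m /= nm; rewrite -ball_normE /= ltr_normE //.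
  by rewrite rnormB; apply: le_lt_trans (tail _ _ nm) (nP _ (leqnn _)).
(* Were the bound to fail at [n], a later term closer to the limit than the excess would contradict
   [tail]. *)
exists (lim (u n @[n --> \oo])) => n; rewrite leNgt; apply/negP => lu.
have /near_rnormP := ul; rewrite -subr_gt0 in lu => /(_ _ lu) [N _ NP].
have := NP (maxn N n) (leq_maxl _ _) => /=; apply/negP; rewrite -leNgt.
rewrite lerBlDr; apply: le_trans (rnorm_triangle (u (maxn N n)) _ _) _.
by rewrite lerD2l tail // leq_maxr.
Qed.

End RealNorm.

(** * Fixed points of isometric actions of compact groups *)

Section Mean.
Context {R : realType} {V : completeNormedModType R[i]} {I : eqType}.
Implicit Types (s : seq I) (F : I -> V) (c : V).

Definition mean s F : V := ((size s)%:R^-1 : R)%:C *: \sum_(i <- s) F i.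

Lemma linear_mean (A : V -> V) s F :
  linear A -> A (mean s F) = mean s (fun i => A (F i)).
Proof.
move=> Alin.
have A0 : A 0 = 0 by have := Alin (-1) 0 0; rewrite scaler0 addr0 scaleN1r addNr.
rewrite /mean -[X in A X]addr0 Alin A0 addr0; congr (_ *: _).
elim: s => [|i s IH]; first by rewrite !big_nil.
by rewrite !big_cons -{1}[F i]scale1r Alin scale1r IH.
Qed.

Lemma rnorm_mean s F c : s != [::] ->
  rnorm (mean s F - c) <= (size s)%:R^-1 * \sum_(i <- s) rnorm (F i - c).
Proof.
move=> s0; have n0 : (size s)%:R != 0 :> R by rewrite pnatr_eq0 size_eq0.
have -> : mean s F - c = mean s (fun i => F i - c).
  rewrite /mean big_split /= scalerDr; congr (_ + _).
  rewrite big_const_seq count_predT iter_addr_0 -[- c *+ _](@scaler_nat R[i] V) scalerA.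
  rewrite -(rmorph_nat (real_complex R)) /= -rmorphM /= mulVf //.
  by rewrite rmorph1 scale1r.
by rewrite rnormZ ?invr_ge0 ?ler0n // ler_wpM2l ?invr_ge0 ?ler0n ?rnorm_sum.
Qed.

Lemma rnorm_mean_le s F c (r : R) : s != [::] ->
  (forall i, rnorm (F i - c) <= r) -> rnorm (mean s F - c) <= r.
Proof.
move=> s0 Fr; apply: le_trans (rnorm_mean F c s0) _.
have n0 : (0 : R) < (size s)%:R by rewrite ltr0n lt0n size_eq0.
rewrite ler_pdivrMl //; apply: le_trans (ler_sum _ (fun i _ => Fr i)) _.
by rewrite big_const_seq count_predT iter_addr_0 mulr_natl.
Qed.

(** One term within [e] of [c] and the remaining ones within [r] bound the average distance by
    [(e + (n - 1) r) / n], where [n = size s]. This gain drives the contraction of orbits. *)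
Lemma rnorm_mean_drop s F c (r e : R) (j : I) : j \in s ->
  (forall i, rnorm (F i - c) <= r) -> rnorm (F j - c) <= e ->
  rnorm (mean s F - c) <= r - (r - e) / (size s)%:R.
Proof.
move=> js Fr Fj.
have s0 : s != [::] by apply: contraTneq js => ->.
have n0 : (0 : R) < (size s)%:R by rewrite ltr0n lt0n size_eq0.
apply: le_trans (rnorm_mean F c s0) _.
rewrite ler_pdivrMl // mulrBr mulrCA divff ?gt_eqF // mulr1.
rewrite (perm_big _ (perm_to_rem js)) big_cons /=.
have -> : (size s)%:R * r - (r - e) = e + (size (rem j s))%:R * r.
  rewrite size_rem // -subn1 natrB ?lt0n ?size_eq0 //; ring.
apply: lerD => //; apply: le_trans (ler_sum _ (fun i _ => Fr i)) _.
by rewrite big_const_seq count_predT iter_addr_0 mulr_natl.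
Qed.

End Mean.

(** * Averaging orbits over finite nets of the group *)

Section FixedPoint.
Context {R : realType} {V : completeNormedModType R[i]} {G : topologicalGroupType}.
Variable T : G -> V -> V.
Hypothesis T_linear : forall g, linear (T g).
Hypothesis T_contr : forall g x, rnorm (T g x) <= rnorm x.
Hypothesis T1 : forall x, T 1%g x = x.
Hypothesis TM : forall g h x, T (g * h)%g x = T g (T h x).
Hypothesis T_cts : forall x, continuous (T^~ x).
Hypothesis cptG : compact [set: G].

Let T_sub g x y : T g (x - y) = T g x - T g y.
Proof.
by have := T_linear g (-1) y x; rewrite !scaleN1r ![- y + _]addrC => ->; rewrite addrC.
Qed.

(* [z] is in the closed convex hull of the orbit of [x], expressed by the inequalities
   that are inherited from that orbit. *)
Let hull (x z : V) := forall (A : V -> V) c (r : R), linear A ->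
  (forall g, rnorm (A (T g x) - c) <= r) -> forall g, rnorm (A (T g z) - c) <= r.

(** [A \o T g] maps the mean to the mean of the [A (T (g * h) x)], which all lie in the given ball,
    and balls are convex. *)
Let hull_mean x (s : seq G) : s != [::] -> hull x (mean s (T^~ x)).
Proof.
move=> s0 A c r Alin Ar g.
rewrite (linear_mean (A := fun y => A (T g y))); last first.
  by move=> k y y'; rewrite T_linear Alin.
by apply: rnorm_mean_le => // h; rewrite -TM.
Qed.

Let hull_dist x z y (r : R) : hull x z -> (forall g, rnorm (T g x - y) <= r) ->
  rnorm (z - y) <= r.
Proof. by move=> xz xr; rewrite -[z]T1; apply: (xz id). Qed.

(** Compactness is used twice: over [t], to make closeness near a given [h] uniform along the orbit
    of [x], and then over [h], to extract a finite net. *)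
Lemma orbit_net x (e : R) : 0 < e -> exists s : seq G, forall g,
  exists2 h, h \in s & forall t, rnorm (T (g * t)%g x - T (h * t)%g x) <= e.
Proof.
move=> e0.
have near_close h : \forall g \near h,
    forall t, rnorm (T (g * t)%g x - T (h * t)%g x) <= e.
  have/compact_near_coveringP/(_ _ _ (fun g t =>
      rnorm (T (g * t)%g x - T (h * t)%g x) <= e) (nbhs_filter h)) cov := cptG.
  have {cov}/cov : forall t, [set: G] t -> \forall t' \near t & g \near h,
      rnorm (T (g * t')%g x - T (h * t')%g x) <= e.
    move=> t _.
    have e20 : 0 < e / 2 by rewrite divr_gt0.
    have := @continuous_comp (G * G)%type G V (fun p => (p.1 * p.2)%g) (T^~ x)
      (h, t) (@mulg_cts G (h, t)) (@T_cts x (h * t)%g).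
    move=> /near_rnormP /(_ _ e20) [[U W] /= [Uh Wt] UW].
    exists (W, U); first by [].
    move=> [t' g] /= [Wt' Ug].
    apply: le_trans (rnorm_triangle (T (h * t)%g x) _ _) _.
    rewrite [leRHS]splitr lerD //; first rewrite rnormB.
      by apply/ltW; apply: (UW (g, t')).
    by apply/ltW/(UW (h, t')); split => //=; apply: nbhs_singleton.
  by apply: filterS => g gP t; apply: gP.
(* The filter of properties that hold for all sufficiently large finite lists; the near-covering
   form of compactness along it yields one list that serves every [g]. *)
pose F := [set A : set (seq G) | exists s0 : seq G, forall s : seq G,
  {subset s0 <= s} -> A s].
have FF : Filter F.
  split; first by exists [::].
  - move=> A B [sA AP] [sB BP]; exists (sA ++ sB) => s ss; split.
      by apply: AP => g gs; apply: ss; rewrite mem_cat gs.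
    by apply: BP => g gs; apply: ss; rewrite mem_cat gs orbT.
  - by move=> A B AB [s0 AP]; exists s0 => s /AP /AB.
have/compact_near_coveringP/(_ _ F (fun s g => exists2 h, h \in s &
    forall t, rnorm (T (g * t)%g x - T (h * t)%g x) <= e) FF) cov := cptG.
case: cov => [h _|s /(_ s) sP]; last by exists s => g; apply: sP.
exists ([set g | forall t, rnorm (T (g * t)%g x - T (h * t)%g x) <= e],
        [set s : seq G | h \in s]) => /=.
  by split; [exact: near_close | exists [:: h] => s; apply; rewrite inE].
by move=> [g s] /= [gh hs]; exists h.
Qed.

(** Every orbit point [T k z] is within [e] of some net point [T h z] and within [D] of the others,
    so the mean is closer than [D] to the whole orbit of [z]. Translates of the mean are then
    equally close to each [T h z], hence to their mean. *)
Let mean_contracts x z (s : seq G) (D e : R) :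
  (forall g, exists2 h, h \in s &
    forall t, rnorm (T (g * t)%g x - T (h * t)%g x) <= e) ->
  hull x z -> (forall g, rnorm (T g z - z) <= D) ->
  forall g, rnorm (T g (mean s (T^~ z)) - mean s (T^~ z)) <=
            D - (D - e) / (size s)%:R.
Proof.
move=> net xz zD g; set z' := mean s _.
have s0 : s != [::] by have [h hs _] := net 1%g; apply: contraTneq hs => ->.
have radius k : rnorm (z' - T k z) <= D - (D - e) / (size s)%:R.
  have [h hs khe] := net k.
  apply: rnorm_mean_drop hs _ _.
    by move=> i; rewrite -(mulVKg k i) TM -T_sub; apply: le_trans (T_contr _ _) _.
  (* The net was chosen for [x]; membership of [z] in the hull, tested on [T h - T k] with centre 0,
     carries its estimate over to [z]. *)
  have lin : linear (fun y => T h y - T k y).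
    by move=> a y y'; rewrite !T_linear scalerBr opprD addrACA.
  have := xz _ 0 e lin _ 1%g; rewrite T1 subr0; apply => t.
  by rewrite subr0 rnormB -!TM.
rewrite rnormB; apply: rnorm_mean_le => // h.
by rewrite -(mulVKg g h) TM -T_sub; apply: le_trans (T_contr _ _) _; rewrite rnormB.
Qed.

(** A net for [x] with precision [e / 2] serves the whole hull, so its size stays fixed and each
    averaging multiplies the excess of the displacement bound over [e / 2] by the same [q < 1]. *)
Let almost_fixed x (e : R) : 0 < e ->
  exists2 z, hull x z & forall g, rnorm (T g z - z) <= e.
Proof.
move=> e0; have e20 : 0 < e / 2 by rewrite divr_gt0.
have [s net] := orbit_net x e20.
have s0 : s != [::] by have [h hs _] := net 1%g; apply: contraTneq hs => ->.
have n0 : (0 : R) < (size s)%:R by rewrite ltr0n lt0n size_eq0.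
pose q : R := 1 - (size s)%:R^-1.
pose D := \sum_(h <- s) rnorm (T h x - x).
have approx k : exists2 z, hull x z &
    forall g, rnorm (T g z - z) <= e / 2 + D * q ^+ k.
  elim: k => [|k [z xz zD]].
    exists x => // g; have [h hs ghe] := net g.
    apply: le_trans (rnorm_triangle (T h x) _ _) _; rewrite expr0 mulr1 lerD //.
      by have := ghe 1%g; rewrite !mulg1.
    rewrite /D (perm_big _ (perm_to_rem hs)) big_cons /= lerDl.
    by apply: sumr_ge0 => i _; apply: rnorm_ge0.
  exists (mean s (T^~ z)).
    by move=> A c r Alin /(xz _ _ _ Alin); apply: hull_mean.
  move=> g; apply: le_trans (mean_contracts net xz zD g) _.
  rewrite exprS /q le_eqVlt; apply/orP; left; apply/eqP; ring.
have q0 : 0 <= q by rewrite subr_ge0 invf_le1 // ler1n lt0n size_eq0.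
have q1 : q < 1 by rewrite gtrBl invr_gt0.
have [k /(_ k (leqnn k)) kP] := geometric_small D q0 q1 e20.
have [z xz zk] := approx k; exists z => // g.
by apply: le_trans (zk g) _; rewrite [leRHS]splitr lerD // ltW.
Qed.

(* Averages over finer and finer finite nets of [G] converge to a fixed point, which
   replaces the integral of the orbit against the Haar measure. *)
Lemma fixed_point_near x (d : R) : (forall g, rnorm (T g x - x) <= d) ->
  exists2 z, (forall g, T g z = z) & rnorm (z - x) <= d.
Proof.
move=> xd; pose h : R := 2^-1.
have h0 : 0 <= h by rewrite invr_ge0.
have h1 : h < 1 by rewrite invf_lt1 // ltr1n.
have hn n : 0 < h ^+ n by rewrite exprn_gt0 // invr_gt0.
have /choice[nxt nxtP] : forall p : V * nat, exists z, hull p.1 z /\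
    forall g, rnorm (T g z - z) <= h ^+ p.2.
  by move=> [z n]; have [z' zz' z'n] := almost_fixed z (hn n); exists z'.
(* Already [u 0] is an average, so that the orbit of [u n] stays within [h ^+ n] of [u n] at every
   index, 0 included. *)
pose u := fix u n := if n is m.+1 then nxt (u m, n) else nxt (x, 0).
have u_osc n g : rnorm (T g (u n) - u n) <= h ^+ n.
  by case: n => [|n] /=; apply: (nxtP (_, _)).2.
have u_hull n : hull x (u n).
  elim: n => [|n IH]; first exact: (nxtP (x, 0)).1.
  by move=> A c r Alin /(IH _ _ _ Alin); apply: (nxtP (_, _)).1.
have u_step n : rnorm (u n.+1 - u n) <= 1 * h ^+ n.
  by rewrite mul1r; apply: hull_dist (nxtP (_, _)).1 _ => g; apply: u_osc.
have [l ul] := geometric_cvg h0 h1 u_step.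
set C := _ / _ in ul.
exists l => [g|].
  apply/eqP; rewrite -subr_eq0; apply/eqP.
  apply: (geometric_eq0 (C := C + (1 + C)) h0 h1) => n.
  apply: le_trans (rnorm_triangle (T g (u n)) _ _) _; rewrite mulrDl lerD //.
    by rewrite -T_sub; apply: le_trans (T_contr _ _) _.
  apply: le_trans (rnorm_triangle (u n) _ _) _.
  by rewrite mulrDl mul1r lerD // rnormB.
(* Each [u n] lies in the hull of [x], hence within [d] of [x]; the limit cannot exceed [d] by a
   positive margin. *)
rewrite leNgt -subr_gt0; apply/negP => /(geometric_small C h0 h1)[n].
move=> /(_ n (leqnn n)); apply/negP; rewrite -leNgt lerBlDr.
apply: le_trans (rnorm_triangle (u n) _ _) _; rewrite lerD //.
exact: hull_dist (u_hull n) _.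
Qed.

End FixedPoint.

(** * Contractivity of *-homomorphisms *)

Section CStarAlgebra.
Context {R : realType} {E : cstarAlgType R}.
Implicit Types (x y z h u w : E) (r : R).

Let half : R[i] := (2^-1 : R)%:C.

Let half_split x : half *: x + half *: x = x.
Proof.
rewrite -scalerDl -rmorphD /=; have -> : 2^-1 + 2^-1 = 1 :> R by field.
by rewrite rmorph1 scale1r.
Qed.

Let rnorm_half x : rnorm (half *: x) = rnorm x / 2.
Proof. by rewrite rnormZ ?invr_ge0 ?ler0n // mulrC. Qed.

Lemma scaler_mull (k : R[i]) x y : (k *: x) * y = k *: (x * y).
Proof. by rewrite cstar_scalerAl. Qed.

Lemma scaler_mulr (k : R[i]) x y : x * (k *: y) = k *: (x * y).
Proof. by rewrite cstar_scalerAr. Qed.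

Lemma rnormM x y : rnorm (x * y) <= rnorm x * rnorm y.
Proof. by rewrite -lecR rmorphM /= -!normE; apply: cstar_normM. Qed.

Lemma rnorm_mul_le x y (a b : R) :
  rnorm x <= a -> rnorm y <= b -> rnorm (x * y) <= a * b.
Proof.
by move=> xa yb; apply: le_trans (rnormM _ _) _; rewrite ler_pM ?rnorm_ge0.
Qed.

Lemma rnorm_starM x : rnorm (star x * x) = rnorm x ^+ 2.
Proof. by apply: complexI; rewrite rmorphXn /= -!normE; apply: cstar_norm. Qed.

Lemma rnorm_star x : rnorm (star x) = rnorm x.
Proof.
have le y : rnorm y <= rnorm (star y).
  have [->|y0] := eqVneq (rnorm y) 0; first exact: rnorm_ge0.
  by rewrite -(ler_pM2r (_ : 0 < rnorm y)) ?lt_def ?y0 ?rnorm_ge0 // -expr2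
             -rnorm_starM rnormM.
by apply/le_anti; rewrite le andbT -{2}(starK x) le.
Qed.

Lemma starMr x y : star (x * y) = star y * star x.
Proof. exact: starM. Qed.

Lemma star1 : star (1 : E) = 1.
Proof. by rewrite -[LHS]mulr1 -[X in star 1 * X]starK -starMr mulr1 starK. Qed.

Lemma starN x : star (- x) = - star x.
Proof. by rewrite -scaleN1r starZ rmorphN rmorph1 scaleN1r. Qed.

Lemma starB x y : star (x - y) = star x - star y.
Proof. by rewrite starD starN. Qed.

Lemma star_real_scale r x : star (r%:C *: x) = r%:C *: star x.
Proof. by rewrite starZ; congr (_ *: _); apply: conjc_real. Qed.

(** Only an inequality, since the unit of the zero algebra has norm 0. *)
Lemma rnorm1_le1 : rnorm (1 : E) <= 1.
Proof.
have := rnorm_starM 1; rewrite star1 mulr1 => n1.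
have := rnorm_ge0 (1 : E); nra.
Qed.

Lemma rnorm_isometry_le1 x : star x * x = 1 -> rnorm x <= 1.
Proof.
move=> xx; have := rnorm_starM x; rewrite xx => n2.
have := rnorm_ge0 x; have := rnorm1_le1; nra.
Qed.

Lemma unitary_star u : unitary u -> unitary (star u).
Proof. by case=> uu uu'; split; rewrite starK. Qed.

Lemma rnorm_unitary_le1 u : unitary u -> rnorm u <= 1.
Proof. by case=> /rnorm_isometry_le1. Qed.

Lemma rnorm_unitary_mulr u x : unitary u -> rnorm (x * u) <= rnorm x.
Proof. by move=> /rnorm_unitary_le1 u1; rewrite -[leRHS]mulr1 rnorm_mul_le. Qed.

Lemma mul_sub_mul x y z w : x * y - z * w = x * (y - w) + (x - z) * w.
Proof. by rewrite mulrBr mulrBl addrA subrK. Qed.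

(* The fixed point [l] of [s |-> (h ^ 2 + s ^ 2) / 2], a contraction on the ball of radius
   [|h| ^ 2 < 1], satisfies [(1 - l) ^ 2 = 1 - h ^ 2]. *)
Lemma sqrt_one_sub_sqr h : star h = h -> rnorm h < 1 ->
  exists k, [/\ star k = k, h * k = k * h & k * k = 1 - h * h].
Proof.
move=> hsa h1; pose q := rnorm h ^+ 2.
have h0 := rnorm_ge0 h.
have q0 : 0 <= q by rewrite exprn_ge0.
have q1 : q < 1 by rewrite expr_lt1.
pose s := fix s n := if n is m.+1 then half *: (h * h + s m * s m) else 0 : E.
have sS n : s n.+1 = half *: (h * h + s n * s n) by [].
have ssa n : star (s n) = s n.
  elim: n => [|n IH]; first by rewrite /= -[in LHS](subrr 0) starB subrr.
  by rewrite sS star_real_scale starD !starMr IH hsa.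
have sh n : h * s n = s n * h.
  elim: n => [|n IH]; first by rewrite mulr0 mul0r.
  rewrite sS scaler_mulr scaler_mull mulrDr mulrDl -(mulrA h).
  by rewrite -(mulrA (s n)) -IH (mulrA (s n)) -IH -(mulrA h).
have hh : rnorm (h * h) <= q by rewrite /q expr2 rnorm_mul_le.
have sq n : rnorm (s n) <= q.
  elim: n => [|n IH]; first by rewrite rnorm0.
  rewrite sS rnorm_half; have := rnormD (h * h) (s n * s n).
  have := rnorm_mul_le IH IH; nra.
(* A difference of squares splits into two products, each bounded by [q] times the previous step;
   the factor [half] compensates for having two of them. *)
have s_step n : rnorm (s n.+1 - s n) <= rnorm (s 1) * q ^+ n.
  elim: n => [|n IH]; first by rewrite subr0 mulr1.
  rewrite [s n.+2]sS {2}[s n.+1]sS -scalerBr rnorm_half opprD addrACA subrr add0r.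
  rewrite mul_sub_mul exprSr mulrA; have := rnormD (s n.+1 * (s n.+1 - s n))
    ((s n.+1 - s n) * s n).
  have := rnorm_mul_le (sq n.+1) IH; have := rnorm_mul_le IH (sq n); lra.
have [l sl] := geometric_cvg q0 q1 s_step.
set C := _ / _ in sl.
have sl' n : rnorm (s n - l) <= C * q ^+ n by rewrite rnormB.
have lsa : star l = l.
  apply/eqP; rewrite -subr_eq0; apply/eqP.
  apply: (geometric_eq0 (C := C + C) q0 q1) => n.
  apply: le_trans (rnorm_triangle (s n) _ _) _.
  by rewrite mulrDl lerD // -[X in _ - X]ssa -starB rnorm_star.
have lh : h * l = l * h.
  apply/eqP; rewrite -subr_eq0; apply/eqP.
  apply: (geometric_eq0 (C := rnorm h * C + C * rnorm h) q0 q1) => n.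
  apply: le_trans (rnorm_triangle (h * s n) _ _) _.
  rewrite -mulrBr sh -mulrBl [leRHS]mulrDl lerD //.
    by rewrite -mulrA rnorm_mul_le.
  by rewrite mulrAC rnorm_mul_le.
have leq : half *: (h * h + l * l) = l.
  apply/eqP; rewrite -subr_eq0; apply/eqP.
  apply: (geometric_eq0 (C := (rnorm l * C + C * q) + C) q0 q1) => n.
  apply: le_trans (rnorm_triangle (s n.+1) _ _) _.
  rewrite mulrDl lerD //; last first.
    apply: le_trans (sl' _) _; rewrite exprS mulrCA ler_piMl ?(ltW q1) //.
    exact: le_trans (rnorm_ge0 _) (sl n).
  rewrite sS -scalerBr opprD addrACA subrr add0r mul_sub_mul rnorm_half.
  have := rnormD (l * (l - s n)) ((l - s n) * s n).
  have := rnorm_mul_le (lexx (rnorm l)) (sl n).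
  have := rnorm_mul_le (sl n) (sq n).
  have := rnorm_ge0 (l * (l - s n) + (l - s n) * s n); lra.
have leq2 : h * h + l * l = l + l by rewrite -[l in RHS]leq half_split.
exists (1 - l); split; first by rewrite starB star1 lsa.
  by rewrite mulrBr mulrBl lh mulr1 mul1r.
rewrite mulrBr mulr1 mulrBl mul1r opprB addrAC -addrA; congr (_ + _).
by rewrite -addrA -opprD -leq2 opprD addrC addrNK.
Qed.

Let complex_i_mul (k k' : R[i]) x y :
  (k *: x) * (k' *: y) = (k * k') *: (x * y).
Proof. by rewrite scaler_mull scaler_mulr scalerA. Qed.

(** The unitary is [h + i k] with [k] a square root of [1 - h * h]; the cross terms cancel because
    [h] and [k] commute. *)
Lemma selfadjoint_unitary_average h : star h = h -> rnorm h < 1 ->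
  exists2 u, unitary u & h = half *: (u + star u).
Proof.
move=> hsa h1; have [k [ksa hk kk]] := sqrt_one_sub_sqr hsa h1.
pose u := h + 'i *: k.
have su : star u = h - 'i *: k.
  rewrite starD hsa starZ ksa; congr (_ + _); rewrite -scaleNr; congr (_ *: _).
  by apply/eqP; rewrite eq_complex /= oppr0 !eqxx.
have ii : 'i * 'i = -1 :> R[i] by rewrite -expr2 sqr_i.
exists u.
  split; rewrite su mulrDl !mulrDr ?mulNr ?mulrN complex_i_mul ii
    !scaler_mull !scaler_mulr hk scaleN1r opprK kk.
    by rewrite addrA addrK addrC subrK.
  by rewrite addrA subrK addrC subrK.
by rewrite su addrACA subrr addr0 scalerDr half_split.
Qed.

End CStarAlgebra.

Lemma star_hom_unitary (R : realType) (A B : cstarAlgType R) (phi : A -> B) u :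
  star_hom phi -> unitary u -> unitary (phi u).
Proof.
move=> [_ phiM phi1 phi_star] [uu uu'].
by split; rewrite -phi_star -phiM ?uu ?uu' phi1.
Qed.

(* A self-adjoint [h] with [|h| < 1] is the average of a unitary and its adjoint, so that
   [|phi h| <= 1]; the general case follows from the C*-identity. *)
Lemma star_hom_contractive (R : realType) (A B : cstarAlgType R) (phi : A -> B) x :
  star_hom phi -> rnorm (phi x) <= rnorm x.
Proof.
move=> phiH; have [phi_lin phiM phi1 phi_star] := phiH.
have phiD y z : phi (y + z) = phi y + phi z.
  by have := phi_lin 1 y z; rewrite !scale1r.
have phi0 : phi 0 = 0 by apply: (addIr (phi 0)); rewrite -phiD !add0r.
have phiZ k y : phi (k *: y) = k *: phi y.
  by have := phi_lin k y 0; rewrite phi0 !addr0.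
have sa_le1 h : star h = h -> rnorm h < 1 -> rnorm (phi h) <= 1.
  move=> hsa /(selfadjoint_unitary_average hsa)[u uu ->].
  rewrite phiZ phiD rnormZ ?invr_ge0 // phi_star.
  have := rnormD (phi u) (star (phi u)); rewrite rnorm_star.
  have := rnorm_unitary_le1 (star_hom_unitary phiH uu); lra.
rewrite leNgt; apply/negP => xphi.
(* Scaling by the inverse of the midpoint puts [y] strictly inside the unit ball and [phi y]
   strictly outside; [star y * y] then violates [sa_le1]. *)
pose t := (rnorm x + rnorm (phi x)) / 2.
have x0 := rnorm_ge0 x.
have t0 : 0 < t by rewrite /t; lra.
have ti0 : 0 <= t^-1 by rewrite invr_ge0 ltW.
pose y := t^-1%:C *: x.
have y1 : rnorm y < 1 by rewrite rnormZ // ltr_pdivrMl // mulr1 /t; lra.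
have py1 : 1 < rnorm (phi y) by rewrite phiZ rnormZ // ltr_pdivlMl // mulr1 /t; lra.
have yy : star (star y * y) = star y * y by rewrite starMr starK.
have := sa_le1 _ yy; rewrite phiM phi_star !rnorm_starM expr_lt1 ?rnorm_ge0 //.
by move=> /(_ y1); rewrite expr_le1 ?rnorm_ge0 // leNgt py1.
Qed.

(** * Unitary polar part *)

Section Newton.
Context {R : realType} {E : cstarAlgType R}.
Implicit Types (x y z u w p : E) (r : R).

Let half : R[i] := (2^-1 : R)%:C.

(* Newton-Schulz iteration for the unitary factor of the polar decomposition. *)
Definition newton z : E := z + half *: ((1 - z * star z) * z).

(** Rests on [z (1 - star z z) = (1 - z star z) z]. It lets estimates for [z * star z] be applied to
    [star z * z] as well. *)
Lemma star_newton z : star (newton z) = newton (star z).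
Proof.
rewrite /newton starD star_real_scale starMr starB star1 starMr starK.
by rewrite mulrBr mulrBl mulr1 mul1r mulrA.
Qed.

(** With [p] half the defect of [z], the defect after one iteration is [3 p^2 + 2 p^3]: the linear
    term cancels. *)
Let cubic_defect p :
  1 - (1 + p) * (1 - (p + p)) * (1 + p) =
  (p * p + p * p) + p * p + (p * p + p * p) * p.
Proof.
have -> : (1 + p) * (1 - (p + p)) = 1 - p - (p * p + p * p).
  by rewrite mulrDl mul1r mulrBr mulr1 mulrDr opprD !addrA subrK.
rewrite mulrDr mulr1 !mulrBl mul1r.
have -> : 1 - p - (p * p + p * p) + (p - p * p - (p * p + p * p) * p) =
          1 - ((p * p + p * p) + p * p + (p * p + p * p) * p).
  rewrite !opprD !addrA; congr (_ - _ - _).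
  by rewrite -!addrA; congr (1 + _); rewrite addrCA !addrA addrAC -!addrA addKr.
by rewrite opprB addrC subrK.
Qed.

(** The new defect is at most [3 d^2 / 4 + d^3 / 4], which is below [d / 2] for [d <= 1 / 2].
    Halving is weaker than the quadratic rate but suffices for a geometric limit. *)
Lemma newton_defect z (d : R) : d <= 2^-1 -> rnorm (1 - z * star z) <= d ->
  rnorm (1 - newton z * star (newton z)) <= d / 2.
Proof.
move=> d2; set f := 1 - z * star z => fd; pose p := half *: f.
have fsa : star f = f by rewrite /f starB star1 starMr starK.
have psa : star p = p by rewrite star_real_scale fsa.
have pp : p + p = f.
  rewrite -scalerDl -rmorphD /=; have -> : 2^-1 + 2^-1 = 1 :> R by field.
  by rewrite rmorph1 scale1r.
have nz : newton z = (1 + p) * z by rewrite mulrDl mul1r scaler_mull.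
have zz : z * star z = 1 - (p + p) by rewrite pp opprB addrC subrK.
have -> : newton z * star (newton z) = (1 + p) * (1 - (p + p)) * (1 + p).
  by rewrite nz starMr starD star1 psa -zz !mulrA.
rewrite cubic_defect; have pd : rnorm p <= d / 2.
  by rewrite rnormZ ?invr_ge0 ?ler0n //; lra.
have d0 : 0 <= d := le_trans (rnorm_ge0 _) fd.
have P := rnorm_mul_le pd pd; have PP := rnormD (p * p) (p * p).
have PPd : rnorm (p * p + p * p) <= d / 2 * (d / 2) + d / 2 * (d / 2) by lra.
have Q := rnorm_mul_le PPd pd.
apply: le_trans (rnormD _ _) _; have := rnormD (p * p + p * p) (p * p); nra.
Qed.

(** The unitary is the limit of the Newton iterates. The twisted invariance [phi z * w = z] passes
    to each iterate and then to the limit, because *-homomorphisms are contractive. *)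
Lemma unitary_polar z :
  rnorm (1 - z * star z) <= 2^-1 -> rnorm (1 - star z * z) <= 2^-1 ->
  exists2 u, unitary u &
    forall (phi : E -> E) w, star_hom phi -> unitary w ->
      phi z * w = z -> phi u * w = u.
Proof.
move=> zz zz'; pose h : R := 2^-1.
have h0 : 0 <= h by rewrite invr_ge0.
have h1 : h < 1 by rewrite invf_lt1 // ltr1n.
have hn n : h ^+ n.+1 <= h.
  by rewrite exprS ler_piMr // exprn_ile1 // ltW.
have defect x n : rnorm (1 - x * star x) <= h ->
    rnorm (1 - iter n newton x * star (iter n newton x)) <= h ^+ n.+1.
  move=> xh; elim: n => [|n IH] //.
  by rewrite exprSr iterS; apply: newton_defect.
pose zs n := iter n newton z.
have star_zs n : star (zs n) = iter n newton (star z).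
  by elim: n => [//|n IH]; rewrite /zs !iterS star_newton -IH.
have d1 n : rnorm (1 - zs n * star (zs n)) <= h ^+ n.+1 by apply: defect.
have d2 n : rnorm (1 - star (zs n) * zs n) <= h ^+ n.+1.
  by rewrite -{2}(starK (zs n)) star_zs; apply: defect; rewrite starK.
(* The C*-identity gives a squared norm of at most [1 + 1 / 2]. *)
have zs2 n : rnorm (zs n) <= 2.
  have := @rnorm_triangle R E 1 (star (zs n) * zs n) 0.
  rewrite !subr0 rnormB rnorm_starM.
  have := le_trans (d2 n) (hn n); have := @rnorm1_le1 _ E; have := rnorm_ge0 (zs n).
  rewrite /h; nra.
have step n : rnorm (zs n.+1 - zs n) <= 1 * h ^+ n.
  rewrite /zs iterS -/(zs n) /newton addrC addKr rnormZ ?invr_ge0 // mul1r.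
  have := rnorm_mul_le (d1 n) (zs2 n).
  have := exprn_ge0 n h0; rewrite exprS {2}/h; lra.
have [l zl] := geometric_cvg h0 h1 step.
set C := _ / _ in zl.
have limit_eq (x y : E) (D : R) : (forall n, rnorm (x - y) <= D * h ^+ n) -> x = y.
  by move=> xy; apply/eqP; rewrite -subr_eq0; apply/eqP; apply: geometric_eq0 xy.
have zl' n : rnorm (star l - star (zs n)) <= C * h ^+ n by rewrite -starB rnorm_star.
have star_zs2 n : rnorm (star (zs n)) <= 2 by rewrite rnorm_star.
have hnn n : h ^+ n.+1 <= h ^+ n.
  by rewrite exprS ler_piMl ?exprn_ge0 // ltW.
exists l.
  split; apply: (limit_eq _ _ (rnorm l * C + C * 2 + 1)) => n.
    apply: le_trans (rnorm_triangle (star (zs n) * zs n) _ _) _.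
    rewrite [leRHS]mulrDl mul1r lerD //; last by rewrite rnormB (le_trans (d2 n)).
    rewrite mul_sub_mul; apply: le_trans (rnormD _ _) _; rewrite [leRHS]mulrDl lerD //.
      by rewrite -mulrA rnorm_mul_le ?rnorm_star.
    by rewrite mulrAC rnorm_mul_le.
  apply: le_trans (rnorm_triangle (zs n * star (zs n)) _ _) _.
  rewrite [leRHS]mulrDl mul1r lerD //; last by rewrite rnormB (le_trans (d1 n)).
  rewrite mul_sub_mul; apply: le_trans (rnormD _ _) _; rewrite [leRHS]mulrDl lerD //.
    by rewrite -mulrA rnorm_mul_le.
  by rewrite mulrAC rnorm_mul_le.
move=> phi w phiH uw phiz; have [phi_lin phiM phi1 phi_star] := phiH.
have phiB a b : phi (a - b) = phi a - phi b.
  by have := phi_lin (-1) b a; rewrite !scaleN1r ![- _ + _]addrC.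
have phi_zs n : phi (zs n) * w = zs n.
  elim: n => [//|n IH]; rewrite /zs iterS /newton -/(zs n).
  (* The twist cancels here, since [w * star w = 1]; so the correction factor is fixed by [phi] and
     only the right-hand factor is twisted. *)
  have phi_zz : phi (zs n * star (zs n)) = zs n * star (zs n).
    rewrite phiM phi_star -{3 4}IH starMr mulrA -[phi _ * w * _]mulrA.
    by rewrite uw.2 mulr1.
  rewrite addrC phi_lin phiM phiB phi1 phi_zz mulrDl scaler_mull -mulrA IH.
  by rewrite addrC.
apply: (limit_eq _ _ (C + C)) => n.
apply: le_trans (rnorm_triangle (zs n) _ _) _; rewrite mulrDl lerD //.
  rewrite -{1}(phi_zs n) -mulrBl -phiB.
  apply: le_trans (rnorm_unitary_mulr _ uw) _.
  by apply: le_trans (star_hom_contractive _ phiH) _.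
by rewrite rnormB.
Qed.

End Newton.

(** * Cocycle conjugacy for compact groups *)

Section Actions.
Context {R : realType} {G : topologicalGroupType}.

Lemma act1 (A : cstarAlgType R) (alpha : action G A) a : alpha 1%g a = a.
Proof.
have [_ /bij_inj inj] := act_iso alpha 1%g.
by apply: inj; rewrite -actM mulg1.
Qed.

(** The cocycle identity makes [T g z = delta g z * v g] an action, and a unitary [y] fixed by it
    exhibits [v g] as the coboundary [star (delta g y) * y]. *)
Lemma approximate_coboundary (E : cstarAlgType R) (delta : action G E)
    (v : G -> E) (x : E) :
  compact [set: G] -> continuous v -> (forall g, unitary (v g)) ->
  (forall s t, v (s * t)%g = delta s (v t) * v s) ->
  unitary x -> (forall g, rnorm (delta g x * v g - x) <= 8^-1) ->
  exists2 y, unitary y & forall g, delta g y * v g = y.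
Proof.
move=> cptG vcts uv vM ux vx.
pose T g z := delta g z * v g.
have delta_hom g : star_hom (delta g) by case: (act_iso delta g).
have T_linear g : linear (T g).
  move=> k a b; rewrite /T (star_hom_linear (delta_hom g)) mulrDl.
  by rewrite scaler_mull.
have T_contr g z : rnorm (T g z) <= rnorm z.
  apply: le_trans (rnorm_unitary_mulr _ (uv g)) _.
  exact: star_hom_contractive.
have T1 z : T 1%g z = z.
  rewrite /T act1; suff -> : v 1%g = 1 by rewrite mulr1.
  have := congr1 (fun w => w * star (v 1%g)) (vM 1%g 1%g).
  by rewrite mulg1 act1 -mulrA (uv _).2 mulr1 => <-.
have TM g h z : T (g * h)%g z = T g (T h z).
  by rewrite /T actM vM (star_homM (delta_hom g)) mulrA.
have T_cts z : continuous (T^~ z).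
  move=> g; apply/near_rnormP => e e0; rewrite /T.
  have e20 : 0 < e / 2 by rewrite divr_gt0.
  pose m := rnorm (delta g z) + 1.
  have m0 : 0 < m by rewrite ltr_wpDl ?rnorm_ge0.
  have /near_rnormP /(_ _ e20) := @act_cts _ _ _ delta z g.
  have /near_rnormP /(_ _ (divr_gt0 e20 m0)) := vcts g.
  apply: filterS2 => t vt dt; rewrite mul_sub_mul.
  apply: le_lt_trans (rnormD _ _) _; rewrite [ltRHS]splitr; apply: ler_ltD.
    have dm : rnorm (delta g z) <= m by rewrite lerDl.
    apply: le_trans (rnorm_mul_le dm (ltW vt)) _.
    by rewrite mulrC divfK // gt_eqF.
  exact: le_lt_trans (rnorm_unitary_mulr _ (uv t)) _.
have [z Tz zx] := fixed_point_near T_linear T_contr T1 TM T_cts cptG vx.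
have x1 := rnorm_unitary_le1 ux.
have z1 : rnorm z <= 1 + 8^-1.
  by have := rnorm_triangle x z 0; rewrite !subr0; lra.
have sxz : rnorm (star x - star z) <= 8^-1 by rewrite -starB rnorm_star rnormB.
have xz : rnorm (x - z) <= 8^-1 by rewrite rnormB.
have sx1 : rnorm (star x) <= 1 by rewrite rnorm_star.
have sz1 : rnorm (star z) <= 1 + 8^-1 by rewrite rnorm_star.
(* With [z] within [1 / 8] of the unitary [x], the defect is at most [1 / 8 + 9 / 64], inside the
   range of the Newton iteration. *)
have zz : rnorm (1 - z * star z) <= 2^-1.
  rewrite -ux.2 mul_sub_mul; apply: le_trans (rnormD _ _) _.
  have := rnorm_mul_le x1 sxz; have := rnorm_mul_le xz sz1; lra.
have zz' : rnorm (1 - star z * z) <= 2^-1.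
  rewrite -ux.1 mul_sub_mul; apply: le_trans (rnormD _ _) _.
  have := rnorm_mul_le sx1 xz; have := rnorm_mul_le sxz z1; lra.
have [y uy yP] := unitary_polar zz zz'; exists y => // g.
exact: yP (delta_hom g) (uv g) (Tz g).
Qed.

(** The tensor square of [E] also serves as that of [D]: elementary tensors and representations are
    pulled back along [psi], [Phi] is composed with it, and the implementing unitaries stay the
    same. *)
Lemma strongly_self_absorbing_iso (D E : cstarAlgType R) (gamma : action G D)
    (delta : action G E) (psi : D -> E) :
  separable D -> star_iso psi -> equivariant gamma delta psi ->
  strongly_self_absorbing delta -> strongly_self_absorbing gamma.
Proof.
move=> sepD [psiH psi_bij] psi_eqv [_ [T [iota [gamma2 [Phi]]]]].
have [psi_inv psiK psi_invK] := psi_bij.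
have [psi_lin psiM psi1 psi_star] := psiH.
have psi0 : psi 0 = 0.
  by have := psi_lin (-1) 0 0; rewrite !scaleN1r !addNr.
have rep_psi (H : hilbert R) (pi : E -> H -> H) :
    faithful_representation pi -> faithful_representation (fun a => pi (psi a)).
  move=> [[pi_lin pi_cts piP piM pi1 pi_star] pi_inj]; split; first split => //.
  - by move=> k a b h; rewrite psi_lin piP.
  - by move=> a b h; rewrite psiM piM.
  - by move=> h; rewrite psi1 pi1.
  - by move=> a h h'; rewrite pi_star psi_star.
  - by move=> a /pi_inj; rewrite -psi0 => /(bij_inj psi_bij).
move=> [[[iota_l iota_r] iota_dense spatial] iota_eqv PhiI Phi_eqv Phi_appr].
split => //; exists T, (fun a b => iota (psi a) (psi b)), gamma2, (Phi \o psi).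
split.
- split.
  + split=> [b k a a'|a k b b'] /=; first by rewrite psi_lin iota_l.
    by rewrite psi_lin iota_r.
  + suff -> : elementary (fun a b => iota (psi a) (psi b)) = elementary iota by [].
    apply/seteqP; split=> t [a [b ->]]; first by exists (psi a), (psi b).
    by exists (psi_inv a), (psi_inv b); rewrite !psi_invK.
  + case: spatial => H [K [L [tau [pi [rho [Pi [tauP piP rhoP PiP PiE]]]]]]].
    exists H, K, L, tau, (fun a => pi (psi a)), (fun b => rho (psi b)), Pi.
    by split=> //; apply: rep_psi.
- by move=> g a b; rewrite iota_eqv !psi_eqv.
- case: PhiI => [[Phi_lin PhiM Phi1 Phi_star] Phi_bij].
  split; last exact: bij_comp.
  split=> [k a b|a b||a] /=.
  + by rewrite psi_lin Phi_lin.
  + by rewrite psiM PhiM.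
  + by rewrite psi1.
  + by rewrite psi_star Phi_star.
- by move=> g a /=; rewrite psi_eqv Phi_eqv.
- have [w [uw w_cvg w_inv]] := Phi_appr; exists w; split => // a /=.
  by rewrite psi1; apply: w_cvg.
Qed.

Lemma strongly_cocycle_conjugate_refl (D : cstarAlgType R) (gamma : action G D) :
  strongly_cocycle_conjugate gamma gamma.
Proof.
have u1 : unitary (1 : D) by split; rewrite star1 mulr1.
exists id, id, (fun=> 1), (fun=> 1) => alpha'.
have alpha1 g : gamma g 1 = 1 by case: (act_iso gamma g) => [[]].
split => //.
- split; last by split.
  by move=> g; apply: cvg_cst.
- by move=> g b; rewrite star1 mulr1 mul1r.
- by move=> s t; rewrite /alpha' alpha1 mulr1.
- move=> K _ e e0; apply: filterE => n g _.
  by rewrite /alpha' star1 alpha1 mulr1 subrr normr0.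
Qed.

Lemma strongly_cocycle_conjugate_iso (D E : cstarAlgType R) (gamma : action G D)
    (delta : action G E) :
  compact [set: G] -> strongly_cocycle_conjugate gamma delta ->
  exists2 psi : D -> E, star_iso psi & equivariant gamma delta psi.
Proof.
move=> cptG [phi [phi_inv [v [x [[phiH phiK phi_invK] [v_cts [uv ux]] deltaE vM vx]]]]].
have [phi_lin phiM phi1 phi_star] := phiH.
pose alpha' g b := phi (gamma g (phi_inv b)).
have v_alpha' g b : v g * alpha' g b = delta g b * v g.
  by rewrite deltaE -[RHS]mulrA (uv g).1 mulr1.
(* Exchanging [alpha'] for [delta] moves [v s] to the right, the form in which [v] twists an action
   of [G]. *)
have vM' s t : v (s * t)%g = delta s (v t) * v s.
  by rewrite vM -v_alpha'.
have e0 : 0 < (8^-1 : R)%:C by rewrite ltcR invr_gt0.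
have [n _ /(_ n (leqnn n))] := vx _ cptG _ e0.
set xn := x n => vxn.
have near_x g : rnorm (delta g xn * v g - xn) <= 8^-1.
  have uxn := ux n; have ud := star_hom_unitary (act_iso delta g).1 uxn.
  have dstar : delta g (star xn) = star (delta g xn).
    by case: (act_iso delta g) => [[]].
  have := vxn g I; rewrite -/(alpha' g _) ltr_normE //= => /ltW.
  apply: le_trans.
  (* The two ways of measuring how far [v] is from the coboundary of [xn] differ by a unitary factor
     on the right, so the bound carries over. *)
  have -> : delta g xn * v g - xn =
      (v g - xn * alpha' g (star xn)) * (star (v g) * (delta g xn * v g)).
    have -> : alpha' g (star xn) = star (v g) * (star (delta g xn) * v g).
      by rewrite -dstar -v_alpha' mulrA (uv g).1 mul1r.
    rewrite mulrBl !mulrA (uv g).2 mul1r; congr (_ - _).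
    rewrite -!mulrA (mulrA (v g) (star (v g))) (uv g).2 mul1r.
    by rewrite (mulrA (star (delta g xn))) ud.1 mul1r (uv g).1 mulr1.
  rewrite [leRHS]rnormB; set d := v g - _.
  rewrite !mulrA; apply: le_trans (rnorm_unitary_mulr _ (uv g)) _.
  apply: le_trans (rnorm_unitary_mulr _ ud) _.
  exact: rnorm_unitary_mulr (unitary_star (uv g)).
have [y uy yv] := approximate_coboundary cptG v_cts uv vM' (ux n) near_x.
exists (fun a => y * phi a * star y).
  split; last first.
    exists (fun b => phi_inv (star y * b * y)) => [a|b].
      by rewrite -!mulrA uy.1 mulr1 mulrA uy.1 mul1r phiK.
    by rewrite phi_invK -!mulrA uy.2 mulr1 mulrA uy.2 mul1r.
  split=> [k a b|a b||a].
  - by rewrite phi_lin mulrDr mulrDl scaler_mulr scaler_mull.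
  - rewrite phiM -!mulrA; congr (_ * (_ * _)).
    by rewrite (mulrA (star y)) uy.1 mul1r.
  - by rewrite phi1 mulr1 uy.2.
  - by rewrite !starMr starK phi_star mulrA.
move=> g a.
have [_ deltaM _ delta_star] : star_hom (delta g) by case: (act_iso delta g).
rewrite 2!deltaM delta_star.
(* Both factors [v g] are absorbed by [delta g y * v g = y] and its adjoint, which leaves
   conjugation by [y]. *)
have -> : delta g (phi a) = v g * phi (gamma g a) * star (v g).
  by rewrite deltaE phiK.
by rewrite -[y in LHS](yv g) starMr !mulrA.
Qed.

End Actions.

Theorem corollary4p9 (R : realType) (G : topologicalGroupType)
  (hausG : hausdorff_space G) (scG : @second_countable G)
  (cptG : compact [set: G])
  (D : cstarAlgType R) (sepD : separable D) (gamma : action G D) :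
  strongly_self_absorbing gamma <-> semi_strongly_self_absorbing gamma.
Proof.
split=> [ssa|[_ [E [delta [ssa /(strongly_cocycle_conjugate_iso cptG)[psi]]]]]].
  split=> //; exists D, gamma; split => //.
  exact: strongly_cocycle_conjugate_refl.
by move=> psiI psi_eqv; apply: strongly_self_absorbing_iso psiI psi_eqv ssa.
Qed.
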